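(* Let $G$ be an operator system, $\Omega=(\Omega_n)_{n\ge1}$ an open fully matricial $G$-set, and $m,n,p\ge1$. If $k\in A_{m+n+p}(\Omega_{m+n+p})$, then $$(\mathrm{id}\otimes\partial)_{m,n,p}\,\partial_{m,n+p}k=(\partial\otimes\mathrm{id})_{m,n,p}\,\partial_{m+n,p}k .$$
   Context: $\mathfrak{M}_n$ denotes the $n\times n$ complex matrices, $e^{(n)}_{ij}$ its matrix units (the superscript is dropped when the size is clear); $\mathfrak{M}_n(G)=\mathfrak{M}_n\otimes G$. $G$ is an operator system (a unital selfadjoint space of Hilbert space operators, with unit $1$). For $S\in GL(n;\mathbb{C})$, $(\mathrm{Ad}S)(T)=STS^{-1}$, and $(\mathrm{Ad}S\otimes I_G)(T\otimes g)=STS^{-1}\otimes g$; $a\oplus b$ is the block diagonal matrix. A fully matricial $G$-set is a sequence $\Omega=(\Omega_n)_{n\ge1}$ with $\Omega_n\subset\mathfrak{M}_n(G)$, $\Omega_{m+n}\cap(\mathfrak{M}_m(G)\oplus\mathfrak{M}_n(G))=\Omega_m\oplus\Omega_n$, and $(\mathrm{Ad}S\otimes I_G)(\Omega_n)=\Omega_n$ for all $S\in GL(n;\mathbb{C})$. It is open if each $\Omega_n$ is open. $A_{n_1,\dots,n_q}(\Omega_{n_1};\dots;\Omega_{n_q})$ is the algebra of analytic maps $f:\Omega_{n_1}\times\dots\times\Omega_{n_q}\to\mathfrak{M}_{n_1}\otimes\dots\otimes\mathfrak{M}_{n_q}$ that are equivariant: $f((\mathrm{Ad}S_1\otimes I_G)(g^{(1)}),\dots,(\mathrm{Ad}S_q\otimes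 I_G)(g^{(q)}))=((\mathrm{Ad}S_1)\otimes\dots\otimes(\mathrm{Ad}S_q))f(g^{(1)},\dots,g^{(q)})$ for $S_j\in GL(n_j;\mathbb{C})$. The map $\partial_{m,n}:A_{m+n}(\Omega_{m+n})\to A_{m,n}(\Omega_m;\Omega_n)$ is $$(\partial_{m,n}f)(g',g'')=\sum_{1\le i,j\le m}\ \sum_{1\le k,l\le n}\Bigl(\tfrac{d}{d\varepsilon}f(g'\oplus g''+\varepsilon e_{j,k+m}\otimes1)\big|_{\varepsilon=0}\Bigr)_{i,m+l}\,e^{(m)}_{ij}\otimes e^{(n)}_{kl},$$ where $(\cdot)_{i,m+l}$ is the $(i,m+l)$ entry. For $k\in A_{m,n+p}(\Omega_m;\Omega_{n+p})$ and $g\in\Omega_m,g'\in\Omega_n,g''\in\Omega_p$, $$((\mathrm{id}\otimes\partial)_{m,n,p}k)(g,g',g'')=\sum_{a,b\le m}\sum_{c,d\le n}\sum_{e,f\le p}\Bigl(\tfrac{d}{d\varepsilon}k(g;g'\oplus g''+\varepsilon e_{d,n+e}\otimes1)\big|_{\varepsilon=0}\Bigr)_{(a,b)(c,n+f)}e^{(m)}_{ab}\otimes e^{(n)}_{cd}\otimes e^{(p)}_{ef},$$ where the index $(a,b)(c,n+f)$ denotes the coefficient of $e^{(m)}_{ab}\otimes e^{(n+p)}_{c,n+f}$. Respectively, for $k\in A_{m+n,p}(\Omega_{m+n};\Omega_p)$, $$((\partial\otimes\mathrm{id})_{m,n,p}k)(g,g',g'')=\sum_{a,b\le m}\sum_{c,d\le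 n}\sum_{e,f\le p}\Bigl(\tfrac{d}{d\varepsilon}k(g\oplus g'+\varepsilon e_{b,m+c}\otimes1;g'')\big|_{\varepsilon=0}\Bigr)_{(a,m+d)(e,f)}e^{(m)}_{ab}\otimes e^{(n)}_{cd}\otimes e^{(p)}_{ef},$$ where the index $(a,m+d)(e,f)$ denotes the coefficient of $e^{(m+n)}_{a,m+d}\otimes e^{(p)}_{ef}$. *)

(* Defs.v *)
From HB Require Import structures.
From mathcomp Require Import all_boot all_order all_algebra.
From mathcomp Require Import complex mxtens.
From mathcomp Require Import boolp classical_sets functions reals topology.
From mathcomp Require Import normedtype derive.

Set Implicit Arguments.
Unset Strict Implicit.
Unset Printing Implicit Defensive.

Import Order.TTheory GRing.Theory Num.Theory.
Import numFieldNormedType.Exports.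

Local Open Scope classical_set_scope.
Local Open Scope ring_scope.

(* R[i] seen as an abstract numClosedFieldType, which is what gives it the
   topology and normed-space structure of MathComp-Analysis. *)
Definition Cplx (R : realType) : numClosedFieldType := R[i].

(* The inner product is linear in its first argument and conjugate-linear in
   the second one. *)
Record hilbertSpace (R : realType) := HilbertSpace {
  hs_space :> completeNormedModType (Cplx R);
  hs_dot : {dot hs_space for Num.conj};
  hs_normE : forall x : hs_space, `|x| ^+ 2 = hs_dot x x
}.

(* A unital selfadjoint space of bounded operators on a Hilbert space: os_op
   is the inclusion of G in B(H), and os_op_le, os_norm_min say that the norm
   of G is the operator norm. In particular os_op is injective. *)
Record operatorSystem (R : realType) := OperatorSystem {
  os_hilbert : hilbertSpace R;
  os_space :> normedModType (Cplx R);
  os_op : os_space -> os_hilbert -> os_hilbert;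
  os_opP : forall g, linear (os_op g);
  os_op_linear : forall x, linear (fun g => os_op g x);
  os_op_le : forall g x, `|os_op g x| <= `|g| * `|x|;
  os_norm_min : forall g (c : Cplx R), 0 <= c ->
    (forall x, `|os_op g x| <= c * `|x|) -> `|g| <= c;
  os_one : os_space;
  os_oneE : forall x, os_op os_one x = x;
  os_adjoint : forall g, exists h, forall x y,
    hs_dot os_hilbert (os_op g x) y = hs_dot os_hilbert x (os_op h y)
}.

(* M_n(V) = M_n (x) V. The alias carries the C-module structure that 'M[V]_n
   lacks when V is merely a module. The topology is the entrywise one, which
   for an operator system is that of the operator norm of M_n(B(H)). *)
Definition matsp (C : numFieldType) (V : normedModType C) (n : nat) := 'M[V]_n.

Section MatspModule.
Variables (C : numFieldType) (V : normedModType C) (n : nat).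

HB.instance Definition _ := Topological.copy (matsp V n) 'M[V]_n.
HB.instance Definition _ := GRing.Zmodule.copy (matsp V n) 'M[V]_n.

Definition matsp_scale (a : C) (X : matsp V n) : matsp V n :=
  \matrix_(i, j) (a *: X i j).

Fact matsp_scalerA a b X :
  matsp_scale a (matsp_scale b X) = matsp_scale (a * b) X.
Proof. by apply/matrixP => i j; rewrite !mxE scalerA. Qed.

Fact matsp_scale1r : left_id 1 matsp_scale.
Proof. by move=> X; apply/matrixP => i j; rewrite !mxE scale1r. Qed.

Fact matsp_scalerDr : right_distributive matsp_scale +%R.
Proof. by move=> a X Y; apply/matrixP => i j; rewrite !mxE scalerDr. Qed.

Fact matsp_scalerDl X : {morph matsp_scale^~ X : a b / a + b}.
Proof. by move=> a b; apply/matrixP => i j; rewrite !mxE scalerDl. Qed.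

HB.instance Definition _ := GRing.Zmodule_isLmodule.Build C (matsp V n)
  matsp_scalerA matsp_scale1r matsp_scalerDr matsp_scalerDl.

End MatspModule.

Section Analytic.
Variables (C : numFieldType) (E : preTopologicalLmodType C).
Variable (F : normedModType C).

Definition multilinear (j : nat) (A : 'rV[E]_j -> F) : Prop :=
  forall (i : 'I_j) (x : 'rV[E]_j),
    linear (fun u : E => A (\row_l (if l == i then u else x 0 l))).

Definition continuous_hpoly (j : nat) (P : E -> F) : Prop :=
  exists A : 'rV[E]_j -> F,
    [/\ multilinear A, continuous A & forall h, P h = A (const_mx h)].

(* f is, near each point a of U, the uniform sum of a series of continuous
   homogeneous polynomials in x - a. *)
Definition analytic_on (U : set E) (f : E -> F) : Prop :=
  forall a, U a -> exists P : nat -> E -> F,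
    (forall j, continuous_hpoly j (P j)) /\
    exists B : set E, [/\ nbhs a B, B `<=` U &
      {uniform B, (fun N (x : E) => \sum_(j < N) P j (x - a)) @ \oo --> f}].

End Analytic.

Section FullyMatricial.
Variables (R : realType) (G : operatorSystem R).
Local Notation C := (Cplx R).

Definition Ad (n : nat) (S T : 'M[C]_n) : 'M[C]_n := S *m T *m invmx S.

(* T (x) g *)
Definition etens (n : nat) (T : 'M[C]_n) (g : G) : matsp G n :=
  \matrix_(i, j) (T i j *: g).

(* Ad S (x) I_G *)
Definition AdG (n : nat) (S : 'M[C]_n) (X : matsp G n) : matsp G n :=
  \matrix_(i, j) \sum_k \sum_l (S i k * invmx S l j) *: X k l.

Definition dsum (m n : nat) (X : matsp G m) (Y : matsp G n) : matsp G (m + n) :=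
  block_mx X 0 0 Y.

(* The sequence starts at n = 1: Omega 0 is unconstrained and never used. *)
Definition fully_matricial (Omega : forall n, set (matsp G n)) : Prop :=
  (forall m n, (0 < m)%N -> (0 < n)%N ->
     Omega (m + n)%N `&` [set dsum X Y | X in setT & Y in setT]
     = [set dsum X Y | X in Omega m & Y in Omega n]) /\
  (forall n, (0 < n)%N -> forall S : 'M[C]_n, S \in unitmx ->
     [set AdG S X | X in Omega n] = Omega n).

Definition open_fully_matricial (Omega : forall n, set (matsp G n)) : Prop :=
  fully_matricial Omega /\ forall n, (0 < n)%N -> open (Omega n).

(* f \in A_n(U); only the values of f on U matter. *)
Definition fm_analytic (n : nat) (U : set (matsp G n))
    (f : matsp G n -> 'M[C]_n) : Prop :=
  analytic_on U f /\
  forall S X, S \in unitmx -> U X -> f (AdG S X) = Ad S (f X).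

(* M_m (x) M_n is realized as 'M_(m * n) by the Kronecker product; tcoef T a b
   c d is the coefficient of e_ab (x) e_cd in T. *)
Definition tcoef (m n : nat) (T : 'M[C]_(m * n))
    (a b : 'I_m) (c d : 'I_n) : C :=
  T (mxtens_index (a, c)) (mxtens_index (b, d)).

Definition partial (m n : nat) (f : matsp G (m + n) -> 'M[C]_(m + n))
    (g' : matsp G m) (g'' : matsp G n) : 'M[C]_(m * n) :=
  \sum_(i < m) \sum_(j < m) \sum_(k < n) \sum_(l < n)
    (derive1 (fun eps : C =>
       f (dsum g' g''
          + etens (eps *: delta_mx (lshift n j) (rshift m k)) (os_one G))) 0)
      (lshift n i) (rshift m l)
    *: (delta_mx i j *t delta_mx k l).

Definition id_partial (m n p : nat)
    (k : matsp G m -> matsp G (n + p) -> 'M[C]_(m * (n + p)))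
    (g : matsp G m) (g' : matsp G n) (g'' : matsp G p) : 'M[C]_(m * n * p) :=
  \sum_(a < m) \sum_(b < m) \sum_(c < n) \sum_(d < n) \sum_(e < p) \sum_(f < p)
    tcoef (derive1 (fun eps : C =>
             k g (dsum g' g''
                  + etens (eps *: delta_mx (lshift p d) (rshift n e))
                      (os_one G))) 0)
      a b (lshift p c) (rshift n f)
    *: (delta_mx a b *t delta_mx c d *t delta_mx e f).

Definition partial_id (m n p : nat)
    (k : matsp G (m + n) -> matsp G p -> 'M[C]_((m + n) * p))
    (g : matsp G m) (g' : matsp G n) (g'' : matsp G p) : 'M[C]_(m * n * p) :=
  \sum_(a < m) \sum_(b < m) \sum_(c < n) \sum_(d < n) \sum_(e < p) \sum_(f < p)
    tcoef (derive1 (fun eps : C =>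
             k (dsum g g'
                + etens (eps *: delta_mx (lshift n b) (rshift m c))
                    (os_one G)) g'') 0)
      (lshift n a) (rshift m d) e f
    *: (delta_mx a b *t delta_mx c d *t delta_mx e f).

Definition cast_fm (n n' : nat) (e : n = n') (f : matsp G n -> 'M[C]_n) :
    matsp G n' -> 'M[C]_n' :=
  fun X => castmx (e, e) (f (castmx (esym e, esym e) X)).

End FullyMatricial.

(* Main.v *)
(* The idea: both sides have the same coefficients, namely entries of mixed
   second derivatives of k at the block diagonal point g + g' + g'' (direct
   sums) in the directions of a (1,2)-block unit and a (2,3)-block unit, taken
   in opposite orders. No theorem on the symmetry of second derivatives is
   needed. Let w be a 0/1-grading of the indices, Z a point of weight 0 and D a
   direction of weight 1. Conjugation by the diagonal matrix with entries t^w
   maps Z + D to Z + t D, so equivariance forces each entry of k (Z + t D) to be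
   a constant times t^-1, 1 or t for t <> 0; continuity at t = 0 makes it an
   affine function of t. Hence all derivatives involved are finite differences,
   and both sides equal the same second difference of k. *)

Require Import Defs.
From mathcomp Require Import all_boot all_order all_algebra.
From mathcomp Require Import mxtens.
From mathcomp Require Import boolp classical_sets reals topology.
From mathcomp Require Import normedtype derive.

Set Implicit Arguments.
Unset Strict Implicit.
Unset Printing Implicit Defensive.

Import Order.TTheory GRing.Theory Num.Theory.
Import numFieldNormedType.Exports.

Local Open Scope classical_set_scope.
Local Open Scope ring_scope.

(** * Continuity of analytic maps along lines, and derivatives of affine maps *)

Lemma cvg_mx (T : Type) (U : topologicalType) (m n : nat) (F : set_system T)
    {FF : Filter F} (f : T -> 'M[U]_(m, n)) (M : 'M[U]_(m, n)) :
  (forall i j, f x i j @[x --> F] --> M i j) -> f x @[x --> F] --> M.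
Proof.
move=> fM A [P MP PA].
apply: (@filterS _ F _ [set x | forall i j, P i j (f x i j)]).
  by move=> x Px; apply: PA.
apply: filter_forall => i; apply: filter_forall => j.
exact: fM (MP i j).
Qed.

Lemma matsp_line_cvg (C : numFieldType) (V : normedModType C) (n : nat)
    (Z D : matsp V n) : (Z + t *: D : matsp V n) @[t --> (0 : C)] --> Z.
Proof.
apply: (@cvg_mx _ _ _ _ (nbhs (0 : C))) => i j.
have -> : (fun t : C => (Z + t *: D) i j) = (fun t : C => Z i j + t *: D i j).
  by apply/funext => t; rewrite !mxE.
rewrite -[X in _ --> X]addr0 -(scale0r (D i j)).
apply: (@cvgD _ _ _ (nbhs (0 : C))).
  exact: (@cvg_cst _ _ _ (nbhs (0 : C))).
apply: (@cvgZr_tmp _ _ _ (nbhs (0 : C))); exact: cvg_id.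
Qed.

(** A partial sum is continuous along the line and approximates [f] uniformly on [B], so an
    epsilon-over-three argument applies. *)
Lemma analytic_on_line_cvg (C : numFieldType) (V W : normedModType C) (n : nat)
    (U : set (matsp V n)) (f : matsp V n -> W) (Z D : matsp V n) :
  analytic_on U f -> U Z -> f (Z + t *: D) @[t --> (0 : C)] --> f Z.
Proof.
move=> fan UZ; have [P [Pc [B [BZ BU Pf]]]] := fan Z UZ.
have Bline : \forall t \near (0 : C), B (Z + t *: D).
  exact: matsp_line_cvg BZ.
(* Each [P N] is a continuous multilinear map composed with the diagonal [const_mx], so continuity
   of that map at one point suffices. *)
have Pcvg N : (\sum_(j < N) P j (Z + t *: D - Z)) @[t --> (0 : C)]
    --> \sum_(j < N) P j (Z - Z).
  elim: N => [|N IH].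
    rewrite big_ord0; under eq_fun do rewrite big_ord0.
    exact: (@cvg_cst _ _ _ (nbhs (0 : C))).
  rewrite big_ord_recr /=.
  have -> : (fun t => \sum_(j < N.+1) P j (Z + t *: D - Z)) =
      (fun t => \sum_(j < N) P j (Z + t *: D - Z) + P N (Z + t *: D - Z)).
    by apply/funext => t; rewrite big_ord_recr.
  apply: (@cvgD _ _ _ (nbhs (0 : C))) => //; have [A [_ Ac PA]] := Pc N.
  rewrite PA; under eq_fun do rewrite PA.
  apply: (cvg_comp (fun t : C => const_mx (Z + t *: D - Z) : 'rV[matsp V n]_N) A
    _ (Ac _)).
  apply: (@cvg_mx _ _ _ _ (nbhs (0 : C))) => i j.
  rewrite mxE subrr.
  under eq_fun do rewrite mxE addrC addKr -[_ *: _]add0r.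
  exact: matsp_line_cvg.
apply/(@cvg_app_entourageP _ _ _ (nbhs (0 : C))) => A entA.
(* Three comparisons are chained: [f Z] with its partial sum, the partial sums at [Z] and
   [Z + t *: D], and the last one with [f (Z + t *: D)]. Uniform closeness is used in both
   directions, hence the intersection with the inverse of [E]. *)
have entA2 := entourage_split_ent entA.
pose E := split_ent (split_ent A).
have entE : entourage E by exact: entourage_split_ent.
have /Pf : nbhs (f : {uniform` B -> W})
    [set h | forall y, B y -> (E `&` E^-1%relation) (f y, h y)].
  apply/uniform_nbhs; exists (E `&` E^-1%relation).
  by split => //; exact: entourage_invI.
case=> N _ /(_ N (leqnn N)) /= fN.
near=> t.
apply: (entourage_split (\sum_(j < N) P j (Z + t *: D - Z))) => //; last first.
  apply: split_ent_subset => //; apply: (proj2 (fN _ _)).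
  by near: t.
apply: (entourage_split (\sum_(j < N) P j (Z - Z))) => //.
  by apply: (proj1 (fN _ _)); apply: nbhs_singleton.
by near: t; move/(@cvg_app_entourageP _ _ _ (nbhs (0 : C))): (Pcvg N); apply.
Unshelve. all: by end_near. Qed.

Lemma derive1_affine (C : numFieldType) (W : normedModType C) (f : C -> W)
    (A : W) :
  (forall t, f t = f 0 + t *: A) -> derive1 f 0 = A.
Proof.
move=> fA; rewrite /derive1; apply: lim_near_cst; first exact: norm_hausdorff.
near=> h; have h0 : h != 0 by near: h; exact: nbhs_dnbhs_neq.
by rewrite addr0 fA addrC addKr scalerA mulVf ?scale1r.
Unshelve. all: by end_near. Qed.

(** The slope of an affine entry is its value at 1 minus its value at 0, so the derivative turns
    into a finite difference. *)
Lemma derive1_mx_affine (C : numFieldType) (m n : nat) (f : C -> 'M[C]_(m, n)) :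
  (forall i j, exists c, forall t, f t i j = f 0 i j + t * c) ->
  derive1 f 0 = f 1 - f 0.
Proof.
move=> fc; apply: derive1_affine => t; apply/matrixP => i j; rewrite !mxE.
by have [c fcE] := fc i j; rewrite (fcE t) (fcE 1) mul1r
  [in RHS](addrC _ c) addrK.
Qed.

(** Carries to [t = 0] the identities that conjugation yields only for invertible [t]; limits along
    the punctured neighbourhood are unique. *)
Lemma cvg_dnbhs0_eq (C : numFieldType) (u v : C -> C) (a b : C) :
  u t @[t --> (0 : C)] --> a -> v t @[t --> (0 : C)] --> b ->
  (forall t, t != 0 -> u t = v t) -> a = b.
Proof.
move=> ua vb uv.
apply: (@cvg_unique C _ (v t @[t --> 0^'])); first exact: norm_hausdorff.
  have : u t @[t --> 0^'] --> a.
    by apply: cvg_trans ua; apply: cvg_app; exact: cvg_within.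
  apply: cvg_trans; apply: near_eq_cvg; near=> t.
  by rewrite uv //; near: t; exact: nbhs_dnbhs_neq.
by apply: cvg_trans vb; apply: cvg_app; exact: cvg_within.
Unshelve. all: by end_near. Qed.

(** * Gradings of the indices and conjugation by diagonal matrices *)

Section Grading.
Variables (R : realType) (G : operatorSystem R).
Local Notation C := (Cplx R).

(* Z has weight 0 when w i = w j wherever Z i j <> 0, and D has weight 1 when
   w i - w j = 1 wherever D i j <> 0. *)
Definition homog0 n (w : pred 'I_n) (Z : matsp G n) : Prop :=
  forall i j, w i != w j -> Z i j = 0.

Definition homog1 n (w : pred 'I_n) (D : matsp G n) : Prop :=
  forall i j, ~~ (w i && ~~ w j) -> D i j = 0.

Definition wscale_mx n (w : pred 'I_n) (t : C) : 'M[C]_n :=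
  diag_mx (\row_i (if w i then t else 1)).

Lemma homog0D n (w : pred 'I_n) (Y Z : matsp G n) :
  homog0 w Y -> homog0 w Z -> homog0 w (Y + Z).
Proof. by move=> wY wZ i j wij; rewrite mxE wY ?wZ ?addr0. Qed.

Lemma wscale_mxV n (w : pred 'I_n) (t : C) : t != 0 ->
  wscale_mx w t *m wscale_mx w t^-1 = 1%:M.
Proof.
move=> t0; rewrite mulmx_diag; apply/matrixP => i j; rewrite !mxE.
by case: (w i); rewrite ?mulfV ?mulr1.
Qed.

Lemma wscale_mx_unit n (w : pred 'I_n) (t : C) : t != 0 ->
  wscale_mx w t \in unitmx.
Proof. by move=> t0; have [] := mulmx1_unit (wscale_mxV w t0). Qed.

Lemma invmx_wscale_mx n (w : pred 'I_n) (t : C) : t != 0 ->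
  invmx (wscale_mx w t) = wscale_mx w t^-1.
Proof.
by move=> t0; rewrite -[LHS]mulmx1 -(wscale_mxV w t0) mulKmx ?wscale_mx_unit.
Qed.

Lemma Ad_wscale_mx n (w : pred 'I_n) (t : C) (T : 'M[C]_n) i j : t != 0 ->
  Ad (wscale_mx w t) T i j
  = (if w i then t else 1) * T i j * (if w j then t^-1 else 1).
Proof.
by move=> t0; rewrite /Ad invmx_wscale_mx // mul_diag_mx mul_mx_diag !mxE.
Qed.

Lemma AdG_wscale_mx n (w : pred 'I_n) (t : C) (X : matsp G n) i j : t != 0 ->
  AdG (wscale_mx w t) X i j
  = ((if w i then t else 1) * (if w j then t^-1 else 1)) *: X i j.
Proof.
move=> t0; rewrite mxE invmx_wscale_mx // (big_only1 i) //.
  rewrite (big_only1 j) // ?mxE ?eqxx //.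
  by move=> l lj _; rewrite !mxE (negPf lj) mulr0 scale0r.
move=> k ki _; rewrite big1 // => l _.
by rewrite !mxE eq_sym (negPf ki) mul0r scale0r.
Qed.

(** Entry [(i, j)] is multiplied by [t ^ (w i - w j)], with exponent 0 where [Z] may be nonzero and
    exponent 1 where [D] may be. *)
Lemma AdG_wscale_line n (w : pred 'I_n) (Z D : matsp G n) (s t : C) :
  homog0 w Z -> homog1 w D -> t != 0 ->
  AdG (wscale_mx w t) (Z + s *: D) = Z + (t * s) *: D.
Proof.
move=> wZ wD t0; apply/matrixP => i j; rewrite AdG_wscale_mx //= !mxE.
case: (boolP (w i && ~~ w j)) => [/andP[wi wj] | wij].
  by rewrite wi (negPf wj) mulr1 wZ ?wi ?(negPf wj) // !add0r scalerA.
rewrite (wD _ _ wij) !scaler0 !addr0.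
have [wE | wE] := eqVneq (w i) (w j); last by rewrite wZ // scaler0.
by rewrite wE; case: (w j); rewrite ?mulfV ?mulr1 // scale1r.
Qed.

Variables (n : nat) (U : set (matsp G n)).
Hypotheses (Uopen : open U)
  (UAd : forall (S : 'M[C]_n) X, S \in unitmx -> U X -> U (AdG S X)).

(** Openness puts [Z + s *: D] in [U] for some small [s != 0]; conjugation with parameter [t / s]
    then moves this point to [Z + t *: D]. *)
Lemma homog_line_mem (w : pred 'I_n) (Z D : matsp G n) (t : C) :
  homog0 w Z -> homog1 w D -> U Z -> U (Z + t *: D).
Proof.
move=> wZ wD UZ; have [->|t0] := eqVneq t 0; first by rewrite scale0r addr0.
have Uline : \forall s \near (0 : C), U (Z + s *: D).
  by apply: matsp_line_cvg; exact: open_nbhs_nbhs.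
have [s [s0 Us]] : exists s : C, s != 0 /\ U (Z + s *: D).
  apply: (@filter_ex _ (0 : C)^'); near=> s; split.
    by near: s; exact: nbhs_dnbhs_neq.
  by near: s; exact: cvg_within Uline.
have ts0 : t / s != 0 by rewrite mulf_neq0 ?invr_eq0.
rewrite -[t](divfK s0) -(AdG_wscale_line _ wZ wD ts0).
by apply: UAd => //; exact: wscale_mx_unit.
Unshelve. all: by end_near. Qed.

Lemma homog_line_affine (f : matsp G n -> 'M[C]_n) (w : pred 'I_n)
    (Z D : matsp G n) i j :
  fm_analytic U f -> homog0 w Z -> homog1 w D -> U Z ->
  exists c, forall t : C, f (Z + t *: D) i j = f Z i j + t * c.
Proof.
move=> [fan fAd] wZ wD UZ.
have ucvg : f (Z + t *: D) i j @[t --> (0 : C)] --> f Z i j.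
  apply: (cvg_comp (fun t : C => f (Z + t *: D)) (fun M : 'M[C]_n => M i j) _
    (@coord_continuous _ _ _ i j _)).
  exact: (analytic_on_line_cvg D fan UZ).
(* The value at [t = 1], from which equivariance recovers the value at every [t != 0]. *)
set c := f (Z + D) i j.
have uE t : t != 0 -> f (Z + t *: D) i j
    = (if w i then t else 1) * c * (if w j then t^-1 else 1).
  move=> t0; rewrite -(Ad_wscale_mx w (f (Z + D)) i j t0).
  rewrite -fAd ?wscale_mx_unit //.
    by rewrite -[D in AdG _ (_ + D)]scale1r AdG_wscale_line // mulr1.
  by rewrite -[D]scale1r; exact: homog_line_mem wZ wD UZ.
have tcvg (a : C) : (t * a) @[t --> (0 : C)] --> (0 * a : C).
  by apply: (@cvgMr_tmp _ _ (nbhs (0 : C))); exact: cvg_id.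
have affineI a : (forall t, t != 0 -> f (Z + t *: D) i j = f Z i j + t * a) ->
    exists a, forall t, f (Z + t *: D) i j = f Z i j + t * a.
  move=> ha; exists a => t; have [->|/ha//] := eqVneq t 0.
  by rewrite scale0r !addr0 mul0r addr0.
(* The four cases correspond to the exponents 0, 1, -1, 0 of [t] in front of [c]. *)
case: (boolP (w i)) (boolP (w j)) uE => wi [] wj uE.
- have fZ : f Z i j = c.
    apply: (cvg_dnbhs0_eq ucvg (@cvg_cst _ c _ (nbhs (0 : C)) _)) => t t0.
    by rewrite uE // mulrC mulKf.
  by apply: (affineI 0) => t t0; rewrite uE // mulrC mulKf // mulr0 addr0.
- have fZ : f Z i j = 0.
    rewrite -(mul0r c); apply: (cvg_dnbhs0_eq ucvg (tcvg c)) => t t0.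
    by rewrite uE // mulr1.
  by apply: (affineI c) => t t0; rewrite uE // fZ mulr1 add0r.
(* Here the entry equals [c / t]. Multiplied by [t] it is constantly [c], yet it tends to
   [0 * f Z i j], so the pole must vanish. *)
- have c0 : c = 0.
    rewrite -(mul0r (f Z i j)).
    apply: (cvg_dnbhs0_eq (@cvg_cst _ c _ (nbhs (0 : C)) _)
      (@cvgM _ _ (nbhs (0 : C)) _ _ _ _ _ (@cvg_id _ _) ucvg)) => t t0 /=.
    by rewrite uE // mul1r mulrC divfK.
  have fZ : f Z i j = 0.
    apply: (cvg_dnbhs0_eq ucvg (@cvg_cst _ 0 _ (nbhs (0 : C)) _)) => t t0.
    by rewrite uE // c0 mulr0 mul0r.
  by apply: (affineI 0) => t t0; rewrite uE // c0 fZ !mulr0 mul0r addr0.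
- have fZ : f Z i j = c.
    apply: (cvg_dnbhs0_eq ucvg (@cvg_cst _ c _ (nbhs (0 : C)) _)) => t t0.
    by rewrite uE // mul1r mulr1.
  by apply: (affineI 0) => t t0; rewrite uE // fZ mul1r mulr1 mulr0 addr0.
Qed.

End Grading.

(** * Coefficients with respect to tensor products of matrix units *)

Lemma tcoefB (R : realType) m n (S T : 'M[Cplx R]_(m * n)) a b c d :
  tcoef (S - T) a b c d = tcoef S a b c d - tcoef T a b c d.
Proof. by rewrite /tcoef !mxE. Qed.

Lemma tcoef_sum (R : realType) m n (I : finType)
    (F : I -> 'M[Cplx R]_(m * n)) a b c d :
  tcoef (\sum_i F i) a b c d = \sum_i tcoef (F i) a b c d.
Proof. by rewrite /tcoef summxE. Qed.

Lemma tcoef_tens (R : realType) m n (t : Cplx R)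
    (a i b j : 'I_m) (c k d l : 'I_n) :
  tcoef (t *: (delta_mx i j *t delta_mx k l)) a b c d
  = t *+ [&& a == i, b == j, c == k & d == l].
Proof.
rewrite /tcoef mxE tensmxE !mxE.
by do 4!case: eqP => _; rewrite /= ?mulr1 ?mulr0 ?mul0r ?mulr0.
Qed.

Lemma tcoef_partial (R : realType) (G : operatorSystem R) m n
    (f : matsp G (m + n) -> 'M[Cplx R]_(m + n)) X Y a b c d :
  tcoef (partial f X Y) a b c d
  = derive1 (fun eps : Cplx R =>
       f (dsum X Y
          + etens (eps *: delta_mx (lshift n b) (rshift m c)) (os_one G))) 0
      (lshift n a) (rshift m d).
Proof.
rewrite tcoef_sum (big_only1 a) // => [|i ia _].
  rewrite tcoef_sum (big_only1 b) // => [|j jb _].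
    rewrite tcoef_sum (big_only1 c) // => [|k kc _].
      rewrite tcoef_sum (big_only1 d) // => [|l ld _].
        by rewrite tcoef_tens !eqxx.
      by rewrite tcoef_tens [d == _]eq_sym (negPf ld) !andbF.
    rewrite tcoef_sum big1 // => l _.
    by rewrite tcoef_tens [c == _]eq_sym (negPf kc) !andbF.
  rewrite tcoef_sum big1 // => k _; rewrite tcoef_sum big1 // => l _.
  by rewrite tcoef_tens [b == _]eq_sym (negPf jb) !andbF.
rewrite tcoef_sum big1 // => j _; rewrite tcoef_sum big1 // => k _.
rewrite tcoef_sum big1 // => l _.
by rewrite tcoef_tens [a == _]eq_sym (negPf ia).
Qed.

(** * Direct sums, matrix units and their weights *)

Section Units.
Variables (R : realType) (G : operatorSystem R).
Local Notation C := (Cplx R).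

Lemma etensZ n (t : C) (T : 'M[C]_n) (g : G) :
  etens (t *: T) g = t *: etens T g.
Proof. by apply/matrixP => i j; rewrite !mxE scalerA. Qed.

Lemma dsumD m n (X X' : matsp G m) (Y Y' : matsp G n) :
  dsum (X + X') (Y + Y') = dsum X Y + dsum X' Y'.
Proof. by rewrite /dsum [RHS]add_block_mx !addr0. Qed.

Lemma dsumZ m n (t : C) (X : matsp G m) (Y : matsp G n) :
  dsum (t *: X) (t *: Y) = t *: dsum X Y.
Proof.
apply/matrixP => i j; rewrite [RHS]mxE.
case: (split_ordP i) => i' ->; case: (split_ordP j) => j' ->;
  rewrite ?(block_mxEul, block_mxEur, block_mxEdl, block_mxEdr) ?mxE //;
  by rewrite scaler0.
Qed.

Lemma etens_delta_dsum0 m n (i j : 'I_m) (g : G) :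
  dsum (etens (delta_mx i j) g) (0 : matsp G n)
  = etens (delta_mx (lshift n i) (lshift n j)) g.
Proof.
apply/matrixP => k l; rewrite [RHS]mxE.
by case: (split_ordP k) => k' ->; case: (split_ordP l) => l' ->;
  rewrite ?(block_mxEul, block_mxEur, block_mxEdl, block_mxEdr) ?mxE
    ?(eq_lshift, eq_rlshift) ?andbF /= ?scale0r.
Qed.

Lemma etens_delta_0dsum m n (i j : 'I_n) (g : G) :
  dsum (0 : matsp G m) (etens (delta_mx i j) g)
  = etens (delta_mx (rshift m i) (rshift m j)) g.
Proof.
apply/matrixP => k l; rewrite [RHS]mxE.
by case: (split_ordP k) => k' ->; case: (split_ordP l) => l' ->;
  rewrite ?(block_mxEul, block_mxEur, block_mxEdl, block_mxEdr) ?mxE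
    ?(eq_rshift, eq_lrshift) ?andbF /= ?scale0r.
Qed.

Lemma castmx_dsumA m n p (X : matsp G m) (Y : matsp G n) (Z : matsp G p) e :
  castmx (e, e) (dsum X (dsum Y Z)) = dsum (dsum X Y) Z.
Proof.
rewrite /dsum; have := @block_mxA G m n p m n p X 0 0 0 Y 0 0 0 Z.
rewrite !row_mx0 !col_mx0 => ->.
by rewrite castmx_comp castmx_id.
Qed.

Lemma castmx_etens_delta n n' (e : n = n') i j (g : G) :
  castmx (e, e) (etens (delta_mx i j : 'M[C]_n) g)
  = etens (delta_mx (cast_ord e i) (cast_ord e j)) g.
Proof. by subst n'; rewrite castmx_id !cast_ord_id. Qed.

Lemma castmx_matspD n n' (e : n = n') (X Y : matsp G n) :
  castmx (e, e) (X + Y) = (castmx (e, e) X + castmx (e, e) Y : matsp G n').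
Proof. by subst n'; rewrite !castmx_id. Qed.

Lemma cast_fm_analytic n n' (e : n = n') (Omega : forall n, set (matsp G n)) f :
  fm_analytic (Omega n) f -> fm_analytic (Omega n') (cast_fm e f).
Proof.
subst n' => fU; suff -> : cast_fm (erefl n) f = f by [].
by apply/funext => X; rewrite /cast_fm !castmx_id.
Qed.

Definition wcat m n (u : pred 'I_m) (v : pred 'I_n) : pred 'I_(m + n) :=
  fun i => match fintype.split i with inl j => u j | inr k => v k end.

Lemma wcat_lshift m n (u : pred 'I_m) (v : pred 'I_n) i :
  wcat u v (lshift n i) = u i.
Proof. by rewrite /wcat (unsplitK (inl i)). Qed.

Lemma wcat_rshift m n (u : pred 'I_m) (v : pred 'I_n) i :
  wcat u v (rshift m i) = v i.
Proof. by rewrite /wcat (unsplitK (inr i)). Qed.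

Lemma homog0_cst n b (X : matsp G n) : homog0 (fun=> b) X.
Proof. by move=> i j; rewrite eqxx. Qed.

Lemma homog0_dsum m n (u : pred 'I_m) (v : pred 'I_n)
    (X : matsp G m) (Y : matsp G n) :
  homog0 u X -> homog0 v Y -> homog0 (wcat u v) (dsum X Y).
Proof.
move=> uX vY i j.
case: (split_ordP i) => i' ->; case: (split_ordP j) => j' ->;
  rewrite ?wcat_lshift ?wcat_rshift
    ?(block_mxEul, block_mxEur, block_mxEdl, block_mxEdr) ?mxE //.
- exact: uX.
- exact: vY.
Qed.

Lemma homog0_delta n (w : pred 'I_n) i j (g : G) :
  w i = w j -> homog0 w (etens (delta_mx i j) g).
Proof.
move=> wij k l; rewrite !mxE.
have [->|] := eqVneq k i; last by rewrite scale0r.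
by have [->|] := eqVneq l j; rewrite ?wij ?eqxx ?scale0r.
Qed.

Lemma homog1_delta n (w : pred 'I_n) i j (g : G) :
  w i -> ~~ w j -> homog1 w (etens (delta_mx i j) g).
Proof.
move=> wi wj k l; rewrite !mxE.
have [->|] := eqVneq k i; last by rewrite scale0r.
by have [->|] := eqVneq l j; rewrite ?wi ?wj ?scale0r.
Qed.

End Units.

(** * The operator [partial] and its derivatives as finite differences *)

Section DeriveOfPartial.
Variables (R : realType) (G : operatorSystem R) (m n : nat).
Variables (U : set (matsp G (m + n))).
Variables (f : matsp G (m + n) -> 'M[Cplx R]_(m + n)).
Hypotheses (Uopen : open U)
  (UAd : forall (S : 'M[Cplx R]_(m + n)) X, S \in unitmx -> U X -> U (AdG S X))
  (fan : fm_analytic U f).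
Local Notation C := (Cplx R).
Local Notation E j k :=
  (etens (delta_mx (lshift n j) (rshift m k)) (os_one G) : matsp G (m + n)).

(** Weight 1 on the first block of indices and 0 on the second makes every block diagonal point of
    weight 0 and every unit [E j k] of weight 1. *)
Lemma dsum_unit_mem X Y j k (t : C) : U (dsum X Y) -> U (dsum X Y + t *: E j k).
Proof.
apply: (homog_line_mem Uopen UAd t (w := wcat predT pred0)).
  by apply: homog0_dsum; exact: homog0_cst.
by apply: homog1_delta; rewrite ?wcat_lshift ?wcat_rshift.
Qed.

Lemma tcoef_partialE X Y a b c d : U (dsum X Y) ->
  tcoef (partial f X Y) a b c d
  = f (dsum X Y + E b c) (lshift n a) (rshift m d)
    - f (dsum X Y) (lshift n a) (rshift m d).
Proof.
move=> UXY; rewrite tcoef_partial derive1_mx_affine => [|i j].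
  by rewrite !etensZ scale1r scale0r addr0 !mxE.
have wXY : homog0 (wcat predT pred0) (dsum X Y).
  by apply: homog0_dsum; exact: homog0_cst.
have wE : homog1 (wcat predT pred0) (E b c).
  by apply: homog1_delta; rewrite ?wcat_lshift ?wcat_rshift.
have [e eE] := homog_line_affine Uopen UAd i j fan wXY wE UXY.
by exists e => t; rewrite !etensZ eE scale0r addr0.
Qed.

(** By [tcoef_partialE] each coefficient is a difference of entries of [f] along the two lines
    through [Z + E j k] and [Z] with direction [D]. A grading giving both base points weight 0 and
    [D] weight 1 makes both entries affine in [t]. It may depend on the unit, since the entries are
    treated one at a time. *)
Lemma tcoef_derive1_partial (X : C -> matsp G m) (Y : C -> matsp G n)
    (Z D : matsp G (m + n)) a b c d :
  U Z -> (forall t, dsum (X t) (Y t) = Z + t *: D) ->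
  (forall j k, exists w, [/\ homog0 w Z, homog0 w (E j k) & homog1 w D]) ->
  tcoef (derive1 (fun t => partial f (X t) (Y t)) 0) a b c d
  = (f (Z + E b c + D) (lshift n a) (rshift m d)
     - f (Z + D) (lshift n a) (rshift m d))
    - (f (Z + E b c) (lshift n a) (rshift m d)
       - f Z (lshift n a) (rshift m d)).
Proof.
move=> UZ XYE wP.
have Z0 : dsum (X 0) (Y 0) = Z by rewrite XYE scale0r addr0.
(* The indices [j] and [k] serve to extract a grading from [wP]. *)
have UXY (j : 'I_m) (k : 'I_n) t : U (dsum (X t) (Y t)).
  by have [w [wZ _ wD]] := wP j k; rewrite XYE; exact: homog_line_mem wZ wD UZ.
have UZE j k : U (Z + E j k).
  by rewrite -[E j k]scale1r -Z0; apply: dsum_unit_mem; rewrite Z0.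
have partE i j k l t : tcoef (partial f (X t) (Y t)) i j k l
    = f (Z + E j k + t *: D) (lshift n i) (rshift m l)
      - f (Z + t *: D) (lshift n i) (rshift m l).
  rewrite tcoef_partialE; last exact: UXY j k t.
  by rewrite XYE addrAC.
rewrite derive1_mx_affine => [|i j].
  by rewrite tcoefB; congr (_ - _);
    rewrite partE ?scale1r ?scale0r ?[_ + 0]addr0.
(* Row [(i1, i2)] and column [(j1, j2)] hold the coefficient of [e_(i1 j1)] tensor [e_(i2 j2)], so
   the unit involved is [E j1 i2]. *)
case: (mxtens_indexP i) => i1 i2; case: (mxtens_indexP j) => j1 j2.
have [w [wZ wE wD]] := wP j1 i2.
have [c1 c1E] := homog_line_affine Uopen UAd (lshift n i1) (rshift m j2)
  fan wZ wD UZ.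
have [c2 c2E] := homog_line_affine Uopen UAd (lshift n i1) (rshift m j2)
  fan (homog0D wZ wE) wD (UZE j1 i2).
exists (c2 - c1) => t.
have entryE s : tcoef (partial f (X s) (Y s)) i1 j1 i2 j2
    = f (Z + E j1 i2) (lshift n i1) (rshift m j2)
      - f Z (lshift n i1) (rshift m j2) + s * (c2 - c1).
  by rewrite partE c2E c1E mulrBr opprD addrACA.
apply: (etrans (entryE t)); congr (_ + _); apply/esym.
by apply: (etrans (entryE 0)); rewrite mul0r addr0.
Qed.

End DeriveOfPartial.

(** * Comparison of the two second differences *)

Theorem lemma7p15 (R : realType) (G : operatorSystem R)
    (Omega : forall n : nat, set (matsp G n)) (m n p : nat)
    (k : matsp G (m + n + p) -> 'M[Cplx R]_(m + n + p)) :
  open_fully_matricial Omega ->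
  (0 < m)%N -> (0 < n)%N -> (0 < p)%N ->
  fm_analytic (Omega (m + n + p)%N) k ->
  forall (g : matsp G m) (g' : matsp G n) (g'' : matsp G p),
    Omega m g -> Omega n g' -> Omega p g'' ->
    id_partial (partial (cast_fm (esym (addnA m n p)) k)) g g' g''
    = partial_id (partial k) g g' g''.
Proof.
move=> [[Odsum OAd] Oopen] m0 n0 p0 kan g g' g'' Og Og' Og''.
have OdsumI a b (X : matsp G a) (Y : matsp G b) : (0 < a)%N -> (0 < b)%N ->
    Omega a X -> Omega b Y -> Omega (a + b)%N (dsum X Y).
  move=> a0 b0 OX OY; suff [] : (Omega (a + b)%N `&`
    [set dsum X Y | X in setT & Y in setT]) (dsum X Y) by [].
  by rewrite Odsum //; exists X => //; exists Y.
have OAdI N (S : 'M_N) X : (0 < N)%N -> S \in unitmx -> Omega N X ->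
    Omega N (AdG S X).
  by move=> N0 Su OX; rewrite -(OAd N N0 S Su); exists X.
have np0 : (0 < n + p)%N by rewrite addn_gt0 n0.
have mn0 : (0 < m + n)%N by rewrite addn_gt0 m0.
have mnp0 : (0 < m + n + p)%N by rewrite addn_gt0 mn0.
have mnp0' : (0 < m + (n + p))%N by rewrite addn_gt0 m0.
rewrite /id_partial /partial_id.
apply: eq_bigr => a _; apply: eq_bigr => b _; apply: eq_bigr => c _.
apply: eq_bigr => d _; apply: eq_bigr => e _; apply: eq_bigr => f _.
congr (_ *: _).
under eq_fun do rewrite etensZ.
under [in RHS]eq_fun do rewrite etensZ.
pose E12 :=
  etens (delta_mx (lshift n b) (rshift m c)) (os_one G) : matsp G (m + n).
pose E23 :=
  etens (delta_mx (lshift p d) (rshift n e)) (os_one G) : matsp G (n + p).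
rewrite (tcoef_derive1_partial (Oopen _ mnp0') (fun S X => @OAdI _ S X mnp0')
  (cast_fm_analytic _ kan) (Z := dsum g (dsum g' g'')) (D := dsum 0 E23));
  first last.
(* [v] gives [E23] weight 1. The first block gets the constant weight [v l], so that the inner unit
   from [j] to [l] has weight 0 wherever [l] lies in the two remaining blocks. *)
- move=> j l; pose v : pred 'I_(n + p) := wcat predT pred0.
  exists (wcat (fun=> v l) v); split.
  + by do 2![apply: homog0_dsum => [|]; try exact: homog0_cst].
  + by apply: homog0_delta; rewrite wcat_lshift wcat_rshift.
  + rewrite etens_delta_0dsum; apply: homog1_delta;
      by rewrite wcat_rshift /v ?wcat_lshift ?wcat_rshift.
- by move=> t; rewrite -dsumZ -dsumD scaler0 addr0.
- by do 2?[apply: (OdsumI) => //].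
rewrite (tcoef_derive1_partial (Oopen _ mnp0) (fun S X => @OAdI _ S X mnp0)
  kan (Z := dsum (dsum g g') g'') (D := dsum E12 0)); first last.
(* Symmetrically, [u] gives [E12] weight 1, and the third block takes the weight of the index [j]
   where the inner unit starts. *)
- move=> j l; pose u : pred 'I_(m + n) := wcat predT pred0.
  exists (wcat u (fun=> u j)); split.
  + by do 2![apply: homog0_dsum => [|]; try exact: homog0_cst].
  + by apply: homog0_delta; rewrite wcat_lshift wcat_rshift.
  + rewrite etens_delta_dsum0; apply: homog1_delta;
      by rewrite wcat_lshift /u ?wcat_lshift ?wcat_rshift.
- by move=> t; rewrite -dsumZ -dsumD scaler0 addr0.
- by do 2?[apply: (OdsumI) => //].
(* Reassociating the blocks brings both sides to entries of [k] at the same four points: the direct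
   sum of [g], [g'] and [g''], with or without each of the two units. *)
rewrite /cast_fm !castmxE /= !castmx_matspD castmx_dsumA.
rewrite etens_delta_0dsum etens_delta_dsum0 !castmx_etens_delta.
have castl (i : 'I_m) : cast_ord (addnA m n p) (lshift _ i)
    = lshift p (lshift n i) by exact: val_inj.
have castm (i : 'I_n) : cast_ord (addnA m n p) (rshift m (lshift p i))
    = lshift p (rshift m i) by exact: val_inj.
have castr (i : 'I_p) : cast_ord (addnA m n p) (rshift m (rshift n i))
    = rshift (m + n) i by apply: val_inj; rewrite /= addnA.
rewrite !esymK !castl !castm !castr.
(* The point containing both units occurs with its summands in opposite orders; afterwards only
   [(x - y) - (z - t) = (x - z) - (y - t)] remains. *)
rewrite [dsum _ _ + _ + _]addrAC.
move: (k _ _ _) (k _ _ _) (k _ _ _) (k _ _ _) => x y z t.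
by rewrite !opprB addrACA [RHS]addrACA [- y + _]addrC.
Qed.
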